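(* Let $(X,\rho,\mathcal{S})$ be an unbounded complete hyperbolic space, let $\theta\in X$, let $\phi$ be an admissible function, let $s\geq1$ and let $\mathcal{M}$ be the set of all nonexpansive self-mappings of $X$. Say that $f\in\mathcal{M}$ has property (R) if for every bounded $B\subset X$ there is a decreasing function $\varphi_{f,B}\colon(0,\infty)\to(0,1)$ such that \[ \rho(f(x),f(y))\leq\varphi_{f,B}(\rho(x,y))\,\rho(x,y) \] for all $x,y\in B$ with $x\neq y$. Then the complement in $\mathcal{M}$ of the set of mappings with property (R) is $\sigma$-porous in $(\mathcal{M},d_{\theta,\phi})$ and $\sigma$-porous in $(\mathcal{M},d_{\theta,s})$.
   Context: Hyperbolic spaces. A geodesic metric space is a metric space $(X,\rho)$ such that for all $x,y\in X$ there is an isometric embedding $c\colon[0,\rho(x,y)]\to X$ with $c(0)=x$, $c(\rho(x,y))=y$; the image of such a $c$ is a metric segment connecting $x$ and $y$. A hyperbolic space is a triple $(X,\rho,\mathcal{S})$ where $(X,\rho)$ is a geodesic metric space and $\mathcal{S}$ is a family of metric segments such that: (1) for each pair $x,y\in X$, $\mathcal{S}$ contains a unique metric segment connecting $x$ and $y$, denoted $[x,y]$; (2) for all $x,y\in X$ and $z,w\in[x,y]$ we have $[z,w]\subset[x,y]$; (3) $\rho((1-\lambda)x\oplus\lambda y,(1-\lambda)x\oplus\lambda z)\leq\lambda\rho(y,z)$ for all $x,y,z\in X$ and $\lambda\in[0,1]$, where $(1-\lambda)x\oplus\lambda y$ denotes the unique point of $[x,y]$ at distance $\lambda\rho(x,y)$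 from $x$ and $(1-\lambda)\rho(x,y)$ from $y$. We write $\bar{B}(z,r)=\{x\in X\colon\rho(x,z)\leq r\}$. Nonexpansive mappings. A mapping $f\colon X\to X$ is nonexpansive if $\rho(f(x),f(y))\leq\rho(x,y)$ for all $x,y\in X$. ''Decreasing'' means non-strictly decreasing. Admissible functions. Let $I$ be $(0,1)$ or $(0,1]$. A function $\phi\colon I\to(0,\infty)$ is called admissible here if it is continuous, strictly increasing and satisfies: (C1) there is an $\eta_\phi\in I$ such that $\phi$ is concave on $(0,\eta_\phi)$ and $\phi(\eta_\phi)\geq\eta_\phi$; (C2) $\lim_{t\to0}\phi(t)=0$ and there is a $t\in I$ with $\phi(t)=1$; (C3) for every $k\in\mathbb{N}$ there is a $C_k>0$ such that $\phi^{-1}(\frac1m)\leq C_k\,\phi^{-1}(\frac1{k+m})$ for all $m\in\mathbb{N}$; (C4) $\sum_{n=1}^\infty n\,\phi^{-1}(\frac1n)$ converges. (Here $\mathbb{N}=\{1,2,\dots\}$.) Metrics. For $f,g\in\mathcal{M}$ put $d_{n,\theta}(f,g)=\sup\{\rho(f(x),g(x))\colon x\in\bar{B}(\theta,n)\}$, $d_{\theta,\phi}(f,g)=\sum_{n=1}^\infty\phi^{-1}\left(\frac1n\right)\frac{d_{n,\theta}(f,g)}{1+d_{n,\theta}(f,g)}$ and $d_{\theta,s}(f,g)=\sup_{x\in X}\frac{\rho(f(x),g(x))}{1+\rho(x,\theta)^s}$. Porosity. A subset $A$ of a metric space $(M,d)$ is porous at $x\in A$ if $\liminf_{r\to0}\gamma(x,r,A)/r>0$,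 where $\gamma(x,r,A)=\sup\{s>0\colon\exists x'\in M\text{ with }B_M(x',s)\subset B_M(x,r)\setminus A\}$, $B_M$ denotes open balls and $\sup\emptyset=-\infty$. $A$ is porous if it is porous at each of its points, and $\sigma$-porous if it is a countable union of porous sets. *)

(* Defs.v *)
From HB Require Import structures.
From mathcomp Require Import all_boot all_order all_algebra.
From mathcomp Require Import all_classical all_reals all_analysis.

Set Implicit Arguments.
Unset Strict Implicit.
Unset Printing Implicit Defensive.

Import Order.TTheory GRing.Theory Num.Theory.
Import numFieldNormedType.Exports.

Local Open Scope classical_set_scope.
Local Open Scope ring_scope.

Section MetricSpaces.
Context {R : realType} {X : metricType R}.

Definition complete_space : Prop :=
  forall F : set_system X, ProperFilter F -> cauchy F -> exists l : X, F --> l.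

Definition mbounded (B : set X) : Prop :=
  exists M : R, forall x y, B x -> B y -> mdist x y <= M.

(* Not the library's [closed_ball], which is the closure of the open ball. *)
Definition cball (z : X) (r : R) : set X := [set x | mdist x z <= r].

(* Only the values of [c] on [0, mdist x y] matter. *)
Definition geodesic_path (x y : X) (c : R -> X) : Prop :=
  [/\ c 0 = x, c (mdist x y) = y &
      {in `[0, mdist x y] &, forall s t, mdist (c s) (c t) = `|s - t|}].

Definition geodesic_space : Prop :=
  forall x y : X, exists c, geodesic_path x y c.

Definition metric_segment (x y : X) (A : set X) : Prop :=
  exists2 c, geodesic_path x y c & A = c @` `[0, mdist x y].

Section Segments.
Variable S : set (set X).

(* [x, y]; the default [set0] is irrelevant when [S] has a unique segment
   connecting [x] and [y]. *)
Definition segment (x y : X) : set X :=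
  xget set0 [set A | S A /\ metric_segment x y A].

(* The point (1 - l) x (+) l y of [x, y]. *)
Definition comb (l : R) (x y : X) : X :=
  xget x [set z | [/\ segment x y z, mdist x z = l * mdist x y
                    & mdist z y = (1 - l) * mdist x y]].

Record hyperbolic_space : Prop := HyperbolicSpace {
  hyp_geodesic : geodesic_space ;
  hyp_family : forall A, S A -> exists x y, metric_segment x y A ;
  hyp_unique : forall x y, exists! A, S A /\ metric_segment x y A ;
  hyp_sub : forall x y z w, segment x y z -> segment x y w ->
    segment z w `<=` segment x y ;
  hyp_comb : forall (x y z : X) (l : R), 0 <= l <= 1 ->
    mdist (comb l x y) (comb l x z) <= l * mdist y z }.

End Segments.

Definition nonexpansive (f : X -> X) : Prop :=
  forall x y, mdist (f x) (f y) <= mdist x y.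

End MetricSpaces.
Arguments complete_space {R} X.
Arguments geodesic_space {R} X.

Record nonexpansive_map (R : realType) (X : metricType R) := NonexpansiveMap {
  nonexpansive_fun :> X -> X ;
  nonexpansive_funP : nonexpansive nonexpansive_fun }.

Definition property_R (R : realType) (X : metricType R)
    (f : nonexpansive_map X) : Prop :=
  forall B : set X, mbounded B ->
  exists vphi : R -> R,
    [/\ forall t : R, 0 < t -> 0 < vphi t < 1,
        forall s t : R, 0 < s -> s <= t -> vphi t <= vphi s
      & forall x y, B x -> B y -> x <> y ->
          mdist (f x) (f y) <= vphi (mdist x y) * mdist x y].

Section Admissible.
Context {R : realType}.

(* A function I -> (0, +oo) is a [phi : R -> R] of which only the values on [I]
   matter; [inv_on I phi] is its inverse, from the image of [I] to [I]. *)
Definition inv_on (I : set R) (phi : R -> R) : R -> R :=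
  'pinv_(fun=> 0) I phi.

Record admissible (I : set R) (phi : R -> R) : Prop := Admissible {
  adm_dom : I = [set` `]0, 1[] \/ I = [set` `]0, 1]] ;
  adm_pos : forall t, I t -> 0 < phi t ;
  adm_continuous : {within I, continuous phi} ;
  adm_increasing : {in I &, {homo phi : s t / s < t}} ;
  adm_concave : exists eta, [/\ I eta,
    convex_function ([set` `]0, eta[] : set R^o) (fun t => - phi t) &
    eta <= phi eta] ;
  adm_lim0 : phi t @[t --> 0^'+] --> 0 ;
  adm_one : exists2 t : R, I t & phi t = 1 ;
  adm_doubling : forall k : nat, (0 < k)%N ->
    exists2 C : R, 0 < C & forall m : nat, (0 < m)%N ->
      inv_on I phi m%:R^-1 <= C * inv_on I phi (k + m)%:R^-1 ;
  adm_summable : cvgn (fun N =>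
    \sum_(1 <= n < N) n%:R * inv_on I phi n%:R^-1 : R) }.

End Admissible.

Section Distances.
Context {R : realType} {X : metricType R} (theta : X).
Implicit Types f g : nonexpansive_map X.

Definition dist_ball (n : nat) f g : R :=
  sup [set mdist (f x) (g x) | x in cball theta n%:R].

Definition dist_phi (I : set R) (phi : R -> R) f g : R :=
  limn (fun N => \sum_(1 <= n < N)
    inv_on I phi n%:R^-1 * (dist_ball n f g / (1 + dist_ball n f g))).

Definition dist_pow (s : R) f g : R :=
  sup [set mdist (f x) (g x) / (1 + mdist x theta `^ s) | x in [set: X]].

End Distances.

Section Porosity.
Context {R : realType} {M : Type} (d : M -> M -> R).

Definition dball (x : M) (r : R) : set M := [set y | d x y < r].

Definition porosity_radius (x : M) (r : R) (A : set M) : \bar R :=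
  ereal_sup [set s%:E | s in [set s : R | 0 < s /\
    exists x', dball x' s `<=` dball x r `\` A]].

Definition porous_at (A : set M) (x : M) : Prop :=
  (0 < limf_einf (fun r : R => porosity_radius x r A * (r^-1)%:E) 0^'+)%E.

Definition porous (A : set M) : Prop := forall x, A x -> porous_at A x.

(* [set0] is porous, so finite unions are included. *)
Definition sigma_porous (A : set M) : Prop :=
  exists2 F : nat -> set M, forall n, porous (F n) & A = \bigcup_n F n.

End Porosity.

(* Main.v *)
(** A map [f] fails (R) exactly when, for some [N], the ratios
    [mdist (f x) (f y) / mdist x y] over the pairs in the ball of radius [N]
    around [theta] with [1/(N+1) <= mdist x y] are not bounded away from [1];
    each of these countably many classes is porous at every map.  Indeed,
    sliding [f x] along the segment towards [f theta] by a proportion [l]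
    yields a [(1 - l)]-Lipschitz map [g] with
    [mdist (f x) (g x) <= l * mdist x theta].  For both metrics this gives
    [d f g <= l * K], with [K = 1] for [dist_pow] and
    [K = \sum_n n * phi^-1(1/n)] for [dist_phi], while small [d]-distances
    control the uniform distance on each ball up to a constant.  So with [l]
    proportional to [r], a whole ball around [g] whose radius is a fixed fraction
    of [r] consists of maps with ratios at most [1 - l/2] on the pairs above. *)

Require Import Defs.
From mathcomp Require Import all_boot all_order all_algebra.
From mathcomp Require Import all_classical all_reals all_analysis.
From mathcomp Require Import ring lra.

Import Order.TTheory GRing.Theory Num.Theory.
Import numFieldNormedType.Exports.

Local Open Scope classical_set_scope.
Local Open Scope ring_scope.

(** * A sufficient criterion for porosity at a point *)

Lemma porous_at_near (R : realType) (M : Type) (d : M -> M -> R)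
    (A : set M) (x : M) (a : R) : 0 < a ->
  (\forall r \near 0^'+, exists x', dball d x' (a * r) `<=` dball d x r `\` A) ->
  porous_at d A x.
Proof.
move=> a0 H; rewrite /porous_at limf_einfE.
apply: (@lt_le_trans _ _ a%:E); first by rewrite lte_fin.
apply: ereal_sup_ge.
(* The lower limit is a supremum of infima over neighbourhoods; [V] is one of them, and every ratio
   over [V] is at least [a]. *)
pose V := [set r : R | 0 < r /\
  exists x', dball d x' (a * r) `<=` dball d x r `\` A].
exists (ereal_inf ((fun r => porosity_radius d x r A * (r^-1)%:E)%E @` V)).
  exists V => //.
  by near=> r; split; [by []|near: r; exact: H].
apply: le_ereal_inf_tmp => _ [r [r0 [x' Hx']] <-].
rewrite -[a](mulfK (lt0r_neq0 r0)) EFinM.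
apply: lee_wpmul2r; first by rewrite lee_fin invr_ge0 ltW.
apply: ereal_sup_ubound; exists (a * r) => //; split; first exact: mulr_gt0.
by exists x'.
Unshelve. all: by end_near. Qed.

(** * Strict contractions near a given nonexpansive map *)

Section Contraction.
Context {R : realType} {X : metricType R} {S : set (set X)}.
Hypothesis hX : hyperbolic_space S.

(** The geodesic tracing the segment, taken at time [l * mdist x y], is a witness, so the choice in
    [comb] does not fall back on its default. *)
Lemma comb_spec (l : R) (x y : X) : 0 <= l <= 1 ->
  mdist x (comb S l x y) = l * mdist x y /\
  mdist (comb S l x y) y = (1 - l) * mdist x y.
Proof.
move=> /andP[l0 l1].
have [_ [c [c0 c1 cI] sE]] :
    S (segment S x y) /\ metric_segment x y (segment S x y).
  case: (hyp_unique hX x y) => A [HA _].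
  by apply: (@xgetPex _ _ [set B | S B /\ metric_segment x y B]); exists A.
have d0 := mdist_ge0 x y.
have lin : l * mdist x y \in `[0, mdist x y].
  by rewrite in_itv /= mulr_ge0 //= ler_piMl.
have : exists z, [/\ segment S x y z, mdist x z = l * mdist x y
                    & mdist z y = (1 - l) * mdist x y].
  exists (c (l * mdist x y)); split.
  - by rewrite sE; exists (l * mdist x y).
  - rewrite -{1}c0 cI //; last by rewrite in_itv /= lexx.
    by rewrite sub0r normrN ger0_norm // mulr_ge0.
  - rewrite -{2}c1 cI //; last by rewrite in_itv /= lexx andbT.
    rewrite distrC -{1}[mdist x y]mul1r -mulrBl ger0_norm // mulr_ge0 //.
    by rewrite subr_ge0.
by move=> /(xgetPex x) [].
Qed.

Lemma exists_contraction (f : nonexpansive_map X) (theta : X) (l : R) :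
  0 <= l <= 1 -> exists g : nonexpansive_map X,
   (forall x y, mdist (g x) (g y) <= (1 - l) * mdist x y) /\
   (forall x, mdist (f x) (g x) <= l * mdist x theta).
Proof.
move=> l01.
have l01' : 0 <= 1 - l <= 1 by move: l01; lra.
(* [hyp_comb] compares segments with a common first endpoint, here [f theta]; hence the parameter
   [1 - l] counted from there. *)
pose g x := comb S (1 - l) (f theta) (f x).
have gl x y : mdist (g x) (g y) <= (1 - l) * mdist x y.
  apply: le_trans (hyp_comb hX _ _ _ l01') _.
  by apply: ler_wpM2l; [case/andP: l01'|exact: nonexpansive_funP].
have gn : nonexpansive g.
  by move=> x y; apply: le_trans (gl x y) _; rewrite ler_piMl ?mdist_ge0; case/andP: l01'.
exists (NonexpansiveMap gn); split => // x /=.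
rewrite metric_sym (comb_spec _ _ _ l01').2 opprB addrC subrK.
apply: ler_wpM2l; first by case/andP: l01.
by rewrite metric_sym; exact: nonexpansive_funP.
Qed.

End Contraction.

(** * The classes of maps failing (R), and their porosity *)

Section NotR.
Context {R : realType} {X : metricType R} (theta : X).
Implicit Types f g h : nonexpansive_map X.

(** The classes increase with [N], so one index can control both the radius and the separation. *)
Definition uncontracted (N : nat) : set (nonexpansive_map X) :=
  [set f | forall c : R, c < 1 -> exists x y,
     [/\ cball theta N%:R x, cball theta N%:R y, N.+1%:R^-1 <= mdist x y
       & c * mdist x y < mdist (f x) (f y)]].

(** A decreasing [vphi] is at most its value at 1/(N+1) on the pairs of class [N], which excludes
    that class. Conversely, if [f] lies in no class, the supremum of the ratios over pairs of [B] at
    distance at least [t] serves as [vphi t]; it decreases because fewer pairs compete as [t]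
    grows. *)
Lemma not_property_RE :
  ~` [set f : nonexpansive_map X | property_R f] = \bigcup_N uncontracted N.
Proof.
apply/seteqP; split=> f /=; last first.
  move=> [N _ fN] fR.
  have [|vphi [v01 vdec fv]] := fR (cball theta N%:R).
    exists (N%:R + N%:R) => x y; rewrite /cball /= => xN yN.
    by apply: le_trans (metric_triangle _ theta _) _; rewrite lerD // metric_sym.
  have N0 : 0 < N.+1%:R^-1 :> R by rewrite invr_gt0.
  have [x [y [xN yN xy]]] := fN _ (proj2 (andP (v01 _ N0))).
  apply/negP; rewrite -leNgt.
  have xy0 : 0 < mdist x y by exact: lt_le_trans xy.
  apply: le_trans (fv _ _ xN yN _) _.
    by move=> E; move: xy0; rewrite E mdistxx ltxx.
  by rewrite ler_wpM2r // ?mdist_ge0 // vdec.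
move=> nR; apply: contrapT => nU; apply: nR => B [M BM].
have contr N : exists2 c : R, c < 1 & forall x y, cball theta N%:R x ->
    cball theta N%:R y -> N.+1%:R^-1 <= mdist x y ->
    mdist (f x) (f y) <= c * mdist x y.
  apply: contrapT => H; apply: nU; exists N => // c c1.
  apply: contrapT => H'; apply: H; exists c => // x y xN yN xy.
  by rewrite leNgt; apply/negP => fxy; apply: H'; exists x, y.
have [D BD] : exists D : R, forall x, B x -> mdist x theta <= D.
  have [->|/set0P[x0 Bx0]] := eqVneq B set0; first by exists 0 => x [].
  exists (M + mdist x0 theta) => x Bx.
  by apply: le_trans (metric_triangle _ x0 _) _; rewrite lerD // BM.
(* Adjoining 1/2 makes the supremum positive, even if no pair of [B] is at distance at least [t]. *)
pose E t := [set (2^-1 : R)] `|` [set u | exists x y, [/\ B x, B y, t <= mdist x y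
  & u = mdist (f x) (f y) / mdist x y]].
have E0 t : (E t) !=set0 by exists 2^-1; left.
have Eub t : 0 < t -> exists2 c : R, c < 1 & ubound (E t) c.
  move=> t0.
  pose N := maxn (Num.truncn D) (Num.truncn t^-1).
  have DN : D < N.+1%:R.
    by apply: lt_le_trans (truncnS_gt _) _; rewrite ler_nat ltnS leq_maxl.
  have tN : N.+2%:R^-1 <= t.
    rewrite -[leRHS]invrK lef_pV2 ?posrE ?invr_gt0 //.
    apply/ltW/(lt_le_trans (truncnS_gt _)); rewrite ler_nat ltnS.
    exact: leq_trans (leq_maxr _ _) (leqnSn _).
  have [c c1 cP] := contr N.+1.
  exists (Num.max 2^-1 c); first by rewrite gt_max c1 andbT invf_lt1 ?ltr1n.
  move=> _ [->|[x [y [Bx By txy ->]]]]; first by rewrite le_max lexx.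
  rewrite le_max; apply/orP; right.
  rewrite ler_pdivrMr ?(lt_le_trans t0) // cP //; last exact: le_trans txy.
  - by apply: le_trans (BD _ Bx) (ltW DN).
  - by apply: le_trans (BD _ By) (ltW DN).
have Ebd t : 0 < t -> has_ubound (E t) by move=> /Eub[c _ ?]; exists c.
exists (fun t => sup (E t)); split.
- move=> t t0; have [c c1 cub] := Eub t t0; apply/andP; split.
    apply: (@lt_le_trans _ _ 2^-1); first by rewrite invr_gt0.
    by apply: ub_le_sup; [exact: Ebd|left].
  by apply: le_lt_trans c1; exact: ge_sup.
- move=> s t s0 st; apply: ge_sup => // u Eu; apply: ub_le_sup; first exact: Ebd.
  case: Eu => [->|[x [y [Bx By txy ->]]]]; [by left|right].
  by exists x, y; split => //; exact: le_trans txy.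
- move=> x y Bx By /eqP; rewrite -mdist_gt0 => xy.
  rewrite -ler_pdivrMr //; apply: ub_le_sup; first exact: Ebd.
  by right; exists x, y.
Qed.

(** Both metrics enter only through these hypotheses on [d]. The threshold [e] is there because
    [dist_phi], a sum of bounded terms, controls displacements only when it is small. *)
Lemma uncontracted_porous (S : set (set X))
    (d : nonexpansive_map X -> nonexpansive_map X -> R) (K : R) (N : nat) (c e : R) :
  hyperbolic_space S ->
  (forall f g h, d f h <= d f g + d g h) ->
  0 < K ->
  (forall f g (l : R), 0 <= l ->
     (forall x, mdist (f x) (g x) <= l * mdist x theta) ->
     d f g <= l * K) ->
  0 < c -> 0 < e ->
  (forall f g x, d f g < e -> cball theta N%:R x -> mdist (f x) (g x) <= c * d f g) ->
  porous d (uncontracted N).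
Proof.
move=> hX tri K0 dK c0 e0 loc f _.
set n : R := N.+1%:R.
have n0 : 0 < n by rewrite ltr0n.
(* The bound 1/2 keeps the ball around [g] inside the one around [f]; the other bound gives
   [c * (a * r) * n <= l / 4] for the [l] below. *)
set a : R := Num.min 2^-1 (8 * K * c * n)^-1.
have B0 : 0 < 8 * K * c * n by rewrite !mulr_gt0.
have a0 : 0 < a by rewrite lt_min !invr_gt0 B0 ltr0n.
have ah : a <= 2^-1 by rewrite ge_min lexx.
have aB : a * (8 * K * c * n) <= 1.
  by rewrite -ler_pdivlMr // mul1r ge_min lexx orbT.
apply: (@porous_at_near _ _ _ _ _ a) => //.
near=> r.
have r0 : 0 < r by [].
have rK : r < K by near: r; exact: nbhs_right_lt.
have re : r < e by near: r; exact: nbhs_right_lt.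
(* Chosen so that [l * K = r / 2]; [r < K] ensures [l <= 1]. *)
set l := r / (2 * K).
have lK : l * (2 * K) = r by rewrite /l mulfVK // lt0r_neq0 // mulr_gt0.
have l0 : 0 < l by rewrite divr_gt0 // mulr_gt0.
have l1 : l <= 1 by rewrite ler_pdivrMr ?mulr_gt0 //; lra.
have [|g [gl fg]] := exists_contraction hX f theta l; first by rewrite l1 ltW.
exists g => h; rewrite /dball /= => gh.
have dfg : d f g <= r / 2.
  have := dK f g l (ltW l0) fg.
  by rewrite -lK; lra.
have ar : a * r <= r / 2 by rewrite mulrC ler_wpM2l // ltW.
split; first by have := tri f g h; lra.
(* The ratio for [g] is at most [1 - l], and passing from [g] to [h] costs at most [l / 4] at each
   of the two points. *)
move=> /(_ (1 - l / 2)) []; first by lra.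
move=> x [y [xN yN xy]]; apply/negP; rewrite -leNgt.
have ghe : d g h < e by lra.
have cgh : c * d g h <= l / 4 * n^-1.
  rewrite ler_pdivlMr //.
  have : c * d g h * n <= c * (a * r) * n by rewrite !ler_wpM2r ?ler_wpM2l ?ltW.
  move: (ler_wpM2r (ltW l0) aB); rewrite -lK; lra.
have cxy : c * d g h <= l / 4 * mdist x y.
  by apply: le_trans cgh _; rewrite ler_wpM2l // divr_ge0 ?ltW.
have gx := loc g h x ghe xN; have gy := loc g h y ghe yN.
have := metric_triangle (h x) (g x) (h y).
have := metric_triangle (g x) (g y) (h y).
have := gl x y.
rewrite (metric_sym (h x) (g x)); lra.
Unshelve. all: by end_near. Qed.

Lemma sigma_porous_not_property_R (S : set (set X))
    (d : nonexpansive_map X -> nonexpansive_map X -> R) (K : R) :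
  hyperbolic_space S ->
  (forall f g h, d f h <= d f g + d g h) ->
  0 < K ->
  (forall f g (l : R), 0 <= l ->
     (forall x, mdist (f x) (g x) <= l * mdist x theta) ->
     d f g <= l * K) ->
  (forall N : nat, exists c e : R, [/\ 0 < c, 0 < e &
     forall f g x, d f g < e -> cball theta N%:R x ->
     mdist (f x) (g x) <= c * d f g]) ->
  sigma_porous d (~` [set f : nonexpansive_map X | property_R f]).
Proof.
move=> hX tri K0 dK loc; exists uncontracted; last exact: not_property_RE.
by move=> N; have [c [e [c0 e0 L]]] := loc N; exact: (@uncontracted_porous S d K N c e).
Qed.

End NotR.

(** * The metric [dist_pow] *)

Section DistPow.
Context {R : realType} {X : metricType R} (theta : X).
Implicit Types f g h : nonexpansive_map X.

(** Linear growth of the displacement makes the suprema defining [dist_pow] and [dist_ball]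
    finite. *)
Lemma mdist_growth f g x :
  mdist (f x) (g x) <= mdist (f theta) (g theta) + 2 * mdist x theta.
Proof.
have := nonexpansive_funP f x theta; have := nonexpansive_funP g theta x.
have := metric_triangle (f x) (f theta) (g x).
have := metric_triangle (f theta) (g theta) (g x).
rewrite (metric_sym theta x); lra.
Qed.

Context {s : R} (hs : 1 <= s).

Lemma le_1powR (t : R) : 0 <= t -> t <= 1 + t `^ s.
Proof.
move=> t0; have [t1|/ltW t1] := leP t 1; first by rewrite ler_wpDr ?powR_ge0.
by rewrite ler_wpDl // le1r_powR.
Qed.

Lemma powR_weight_gt0 (t : R) : 0 < 1 + t `^ s.
Proof. by rewrite ltr_pwDl ?powR_ge0. Qed.

Lemma mdist_le_dist_pow f g x :
  mdist (f x) (g x) <= dist_pow theta s f g * (1 + mdist x theta `^ s).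
Proof.
rewrite -ler_pdivrMr ?powR_weight_gt0 //; apply: ub_le_sup; last by exists x.
exists (mdist (f theta) (g theta) + 2) => _ [y _ <-].
rewrite ler_pdivrMr ?powR_weight_gt0 //.
apply: le_trans (mdist_growth f g y) _.
have := le_1powR _ (mdist_ge0 y theta).
have := mulr_ge0 (mdist_ge0 (f theta) (g theta)) (powR_ge0 (mdist y theta) s).
lra.
Qed.

Lemma dist_pow_le f g (b : R) :
  (forall x, mdist (f x) (g x) <= b * (1 + mdist x theta `^ s)) ->
  dist_pow theta s f g <= b.
Proof.
move=> H; apply: ge_sup.
  by exists (mdist (f theta) (g theta) / (1 + mdist theta theta `^ s)); exists theta.
by move=> _ [y _ <-]; rewrite ler_pdivrMr ?powR_weight_gt0.
Qed.

Lemma dist_pow_triangle f g h :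
  dist_pow theta s f h <= dist_pow theta s f g + dist_pow theta s g h.
Proof.
apply: dist_pow_le => x; rewrite mulrDl.
by apply: le_trans (metric_triangle _ (g x) _) _; rewrite lerD ?mdist_le_dist_pow.
Qed.

Lemma dist_pow_sigma_porous (S : set (set X)) : hyperbolic_space S ->
  sigma_porous (dist_pow theta s) (~` [set f : nonexpansive_map X | property_R f]).
Proof.
move=> hX.
apply: (sigma_porous_not_property_R theta S _ 1 hX dist_pow_triangle) => //.
- move=> f g l l0 H; rewrite mulr1; apply: dist_pow_le => x.
  by apply: le_trans (H x) _; rewrite ler_wpM2l // le_1powR ?mdist_ge0.
(* The factor is the weight at radius [N], its maximum on the ball; the estimate holds at every
   distance, so the threshold 1 is arbitrary. *)
- move=> N; exists (1 + N%:R `^ s), 1; split=> //.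
  move=> f g x _ xN; apply: le_trans (mdist_le_dist_pow f g x) _.
  rewrite mulrC ler_wpM2r //; last first.
    rewrite lerD2l ge0_ler_powR // ?nnegrE ?mdist_ge0 //.
    by apply: le_trans hs.
  have := mdist_le_dist_pow f g x; rewrite -ler_pdivrMr ?powR_weight_gt0 //.
  by apply: le_trans; rewrite divr_ge0 ?mdist_ge0 // ltW // powR_weight_gt0.
Qed.

End DistPow.

(** * Positivity of the coefficients of [dist_phi] *)

Section InverseOfAdmissible.
Context {R : realType} {I : set R} {phi : R -> R} (hphi : admissible I phi).

(** [inv_on] is meaningful only on the image of [I], so 1/n must be attained: [phi] tends to 0 at 0
    and takes the value 1, and the intermediate value theorem applies. *)
Lemma inv_on_natV_gt0 (n : nat) : (0 < n)%N -> 0 < inv_on I phi n%:R^-1.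
Proof.
move=> n0.
have v0 : 0 < n%:R^-1 :> R by rewrite invr_gt0 ltr0n.
have v1 : n%:R^-1 <= 1 :> R by rewrite invf_le1 ?ltr0n // ler1n.
have [t1 It1 pt1] := adm_one hphi.
have Ipos t : I t -> 0 < t.
  by case: (adm_dom hphi) => -> /=; rewrite in_itv /= => /andP[].
have Idown t : 0 < t -> t <= t1 -> I t.
  case: (adm_dom hphi) It1 => -> /=; rewrite !in_itv /= => /andP[_ t11] t0 tt1.
    by rewrite t0 (le_lt_trans tt1).
  by rewrite t0 (le_trans tt1).
have [t0 [t00 t01 pt0]] : exists t0 : R, [/\ 0 < t0, t0 <= t1 & phi t0 < n%:R^-1].
  near (0 : R)^'+ => t0; exists t0; split.
  - by [].
  - by near: t0; apply: nbhs_right_le; exact: Ipos.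
  - by near: t0; apply: (cvgr_lt _ (adm_lim0 hphi)).
have [||c cI pc] := @IVT R phi t0 t1 n%:R^-1 t01.
- apply: (continuous_subspaceW _ (adm_continuous hphi)) => t /=.
  by rewrite in_itv /= => /andP[? ?]; apply: Idown => //; exact: lt_le_trans t00 _.
- by rewrite ge_min (ltW pt0) le_max pt1 v1 orbT.
have Ic : I c.
  by move: cI; rewrite in_itv /= => /andP[? ?]; apply: Idown => //; exact: lt_le_trans t00 _.
apply: Ipos; rewrite -pc /inv_on pinvKV ?inE // => x y xI yI xy.
case: (ltgtP x y) => // lt.
- by have := adm_increasing hphi xI yI lt; rewrite xy ltxx.
- by have := adm_increasing hphi yI xI lt; rewrite xy ltxx.
Unshelve. all: by end_near. Qed.

End InverseOfAdmissible.

(** * Series with nonnegative terms, indexed from 1 *)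

Section PositiveSums.
Context {R : realType}.
Implicit Types u v : nat -> R.

Lemma nondecreasing_psum u : (forall n, (0 < n)%N -> 0 <= u n) ->
  {homo (fun N => \sum_(1 <= n < N) u n) : m n / (m <= n)%N >-> m <= n}.
Proof.
move=> u0; apply/nondecreasing_seqP => -[|N]; first by rewrite !big_geq.
by rewrite [leRHS]big_nat_recr //= lerDl u0.
Qed.

Lemma psum_cvg u v : (forall n, (0 < n)%N -> 0 <= u n <= v n) ->
  cvgn (fun N => \sum_(1 <= n < N) v n) ->
  cvgn (fun N => \sum_(1 <= n < N) u n).
Proof.
move=> uv vc.
have u0 n : (0 < n)%N -> 0 <= u n by move=> /uv/andP[].
have v0 n : (0 < n)%N -> 0 <= v n by move=> /uv/andP[]; exact: le_trans.
apply: nondecreasing_is_cvgn; first exact: nondecreasing_psum.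
exists (limn (fun N => \sum_(1 <= n < N) v n)) => _ [N _ <-].
apply: le_trans (nondecreasing_cvgn_le (nondecreasing_psum _ v0) vc N).
by rewrite !big_nat ler_sum // => n /andP[/uv/andP[]].
Qed.

Lemma le_psum_limn u n : (forall n, (0 < n)%N -> 0 <= u n) -> (0 < n)%N ->
  cvgn (fun N => \sum_(1 <= n < N) u n) ->
  u n <= limn (fun N => \sum_(1 <= n < N) u n).
Proof.
move=> u0 n0 uc.
apply: le_trans (nondecreasing_cvgn_le (nondecreasing_psum _ u0) uc n.+1).
by rewrite big_nat_recr //= lerDr big_nat sumr_ge0 // => i /andP[/u0].
Qed.

End PositiveSums.

(** * Uniform distances on balls *)

Section DistBall.
Context {R : realType} {X : metricType R} (theta : X).
Implicit Types f g h : nonexpansive_map X.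

Lemma mdist_le_dist_ball n f g x : cball theta n%:R x ->
  mdist (f x) (g x) <= dist_ball theta n f g.
Proof.
move=> xn; apply: ub_le_sup; last by exists x.
exists (mdist (f theta) (g theta) + 2 * n%:R) => _ [y yn <-].
by apply: le_trans (mdist_growth theta f g y) _; rewrite lerD2l ler_wpM2l.
Qed.

Lemma dist_ball_le n f g (b : R) :
  (forall x, cball theta n%:R x -> mdist (f x) (g x) <= b) ->
  dist_ball theta n f g <= b.
Proof.
move=> H; apply: ge_sup; last by move=> _ [y yn <-]; exact: H.
by exists (mdist (f theta) (g theta)); exists theta; rewrite /cball /= ?mdistxx.
Qed.

Lemma dist_ball_ge0 n f g : 0 <= dist_ball theta n f g.
Proof.
apply: le_trans (mdist_ge0 (f theta) (g theta)) _.
by apply: mdist_le_dist_ball; rewrite /cball /= mdistxx.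
Qed.

Lemma dist_ball_triangle n f g h :
  dist_ball theta n f h <= dist_ball theta n f g + dist_ball theta n g h.
Proof.
apply: dist_ball_le => x xn.
by apply: le_trans (metric_triangle _ (g x) _) _; rewrite lerD ?mdist_le_dist_ball.
Qed.

End DistBall.

(** * The function [t / (1 + t)] *)

Section Frac1D.
Context {R : realType}.
Implicit Types t u v : R.

Lemma frac1D_ge0 t : 0 <= t -> 0 <= t / (1 + t).
Proof. by move=> t0; rewrite divr_ge0 // addr_ge0. Qed.

Lemma frac1D_le t : 0 <= t -> t / (1 + t) <= t.
Proof.
move=> t0; rewrite ler_pdivrMr; last by rewrite ltr_pwDl.
by rewrite mulrDr mulr1 lerDl mulr_ge0.
Qed.

Lemma frac1D_le1 t : 0 <= t -> t / (1 + t) <= 1.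
Proof.
move=> t0; rewrite ler_pdivrMr; last by rewrite ltr_pwDl.
by rewrite mul1r lerDr.
Qed.

(** The function is increasing, being [1 - (1 + t)^-1], and subadditive, since shrinking the
    denominator [1 + (u + v)] enlarges each part. *)
Lemma frac1D_triangle t u v : 0 <= t -> 0 <= u -> 0 <= v -> t <= u + v ->
  t / (1 + t) <= u / (1 + u) + v / (1 + v).
Proof.
move=> t0 u0 v0 tuv.
have H (w : R) : 0 <= w -> w / (1 + w) = 1 - (1 + w)^-1.
  by move=> w0; field; apply/lt0r_neq0; rewrite ltr_pwDl.
apply: (@le_trans _ _ ((u + v) / (1 + (u + v)))).
  rewrite !H ?addr_ge0 // lerD2l lerN2 lef_pV2 ?posrE ?lerD2l //;
  by rewrite ltr_pwDl // ?addr_ge0.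
rewrite mulrDl; apply: lerD; apply: ler_wpM2l => //;
  by rewrite lef_pV2 ?posrE ?lerD2l ?lerDl ?lerDr // ltr_pwDl // ?addr_ge0.
Qed.

End Frac1D.

(** * The metric [dist_phi] *)

Section DistPhi.
Context {R : realType} {X : metricType R} (theta : X) {I : set R} {phi : R -> R}.
Hypothesis hphi : admissible I phi.
Implicit Types f g h : nonexpansive_map X.

Let a (n : nat) := inv_on I phi n%:R^-1.
Let term f g n := a n * (dist_ball theta n f g / (1 + dist_ball theta n f g)).
Let K := limn (fun N => \sum_(1 <= n < N) n%:R * a n : R).

Let a_gt0 n : (0 < n)%N -> 0 < a n. Proof. exact: inv_on_natV_gt0. Qed.

Let term_ge0 f g n : (0 < n)%N -> 0 <= term f g n.
Proof.
by move=> n0; rewrite mulr_ge0 ?frac1D_ge0 ?dist_ball_ge0 // ltW ?a_gt0.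
Qed.

Let term_cvg f g : cvgn (fun N => \sum_(1 <= n < N) term f g n).
Proof.
(* The fraction is at most 1, hence at most [n], so the series in [adm_summable] dominates. *)
apply: psum_cvg (adm_summable hphi) => n n0.
rewrite term_ge0 //= /term mulrC ler_wpM2r ?(ltW (a_gt0 _ n0)) //.
by apply: le_trans (frac1D_le1 _ (dist_ball_ge0 _ _ _ _)) _; rewrite ler1n.
Qed.

Lemma dist_phi_triangle f g h :
  dist_phi theta I phi f h <= dist_phi theta I phi f g + dist_phi theta I phi g h.
Proof.
rewrite /dist_phi -limD; [|exact: term_cvg|exact: term_cvg].
apply: ler_lim; [exact: term_cvg|by apply: is_cvgD; exact: term_cvg|].
apply: nearW => N.
rewrite [leRHS](_ : _ = \sum_(1 <= n < N) (term f g n + term g h n));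
  last by rewrite big_split.
rewrite !big_nat ler_sum // => n /andP[n0 _].
rewrite -mulrDr ler_wpM2l ?(ltW (a_gt0 _ n0)) //.
by apply: frac1D_triangle; rewrite ?dist_ball_ge0 ?dist_ball_triangle.
Qed.

Lemma dist_phi_sigma_porous (S : set (set X)) : hyperbolic_space S ->
  sigma_porous (dist_phi theta I phi)
    (~` [set f : nonexpansive_map X | property_R f]).
Proof.
move=> hX.
have na0 n : (0 < n)%N -> 0 <= n%:R * a n.
  by move=> /a_gt0/ltW n0; rewrite mulr_ge0.
have K0 : 0 < K.
  have := le_psum_limn _ 1 na0 isT (adm_summable hphi).
  by apply: lt_le_trans; rewrite mul1r a_gt0.
apply: (sigma_porous_not_property_R theta S _ K hX dist_phi_triangle) => //.
- move=> f g l l0 H.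
  apply: limr_le (term_cvg f g) _; apply: nearW => N.
  apply: (@le_trans _ _ (l * \sum_(1 <= n < N) n%:R * a n)); last first.
    rewrite ler_wpM2l //.
    exact: nondecreasing_cvgn_le (nondecreasing_psum _ na0) (adm_summable hphi) N.
  rewrite mulr_sumr !big_nat ler_sum // => n /andP[n0 _].
  rewrite /term [leRHS]mulrA [leLHS]mulrC ler_wpM2r ?(ltW (a_gt0 _ n0)) //.
  (* On the ball of radius [n] the displacement is at most [l * n], whence the factor [n] in [K]. *)
  apply: le_trans (frac1D_le _ (dist_ball_ge0 _ _ _ _)) _.
  apply: dist_ball_le => x xn; apply: le_trans (H x) _.
  by rewrite ler_wpM2l.
- move=> N.
  have aN : 0 < a N.+1 by exact: a_gt0.
  (* The index is [N.+1] because the series starts at 1 and [N] may be 0. The threshold forces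
     [D / (1 + D) < 1/2], so [D < 1] and [D / 2 <= D / (1 + D)], which gives the factor
     [2 / a N.+1]. *)
  exists (2 / a N.+1), (a N.+1 / 2); split; rewrite ?divr_gt0 // => f g x dfg xN.
  set D := dist_ball theta N.+1 f g.
  have D0 : 0 <= D by exact: dist_ball_ge0.
  have xD : mdist (f x) (g x) <= D.
    by apply: mdist_le_dist_ball; rewrite /cball /=; apply: le_trans xN _; rewrite ler_nat.
  have tD : a N.+1 * (D / (1 + D)) <= dist_phi theta I phi f g.
    exact: le_psum_limn _ _ (term_ge0 f g) _ (term_cvg f g).
  have D1 : 0 < 1 + D by rewrite ltr_pwDl.
  have D2 : D < 1.
    have : a N.+1 * (D / (1 + D)) < a N.+1 * 2^-1 by exact: le_lt_trans tD dfg.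
    by rewrite ltr_pM2l // ltr_pdivrMr //; lra.
  apply: le_trans xD _; rewrite mulrAC ler_pdivlMr //.
  have : D / 2 <= D / (1 + D).
    by rewrite ler_wpM2l // lef_pV2 ?posrE //; lra.
  move=> /(ler_wpM2l (ltW aN)); lra.
Qed.

End DistPhi.

Theorem corollary3p7 (R : realType) (X : metricType R) (S : set (set X))
    (theta : X) (I : set R) (phi : R -> R) (s : R)
    (hX : hyperbolic_space S) (cX : complete_space X)
    (uX : ~ mbounded [set: X])
    (hphi : admissible I phi) (hs : 1 <= s) :
  sigma_porous (dist_phi theta I phi)
    (~` [set f : nonexpansive_map X | property_R f]) /\
  sigma_porous (dist_pow theta s)
    (~` [set f : nonexpansive_map X | property_R f]).
Proof.
split; first exact: (dist_phi_sigma_porous theta hphi S).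
exact: (dist_pow_sigma_porous theta hs S).
Qed.
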